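(* Over the finite field $\mathbb{F}_2$ there are exactly $2$, $7$ and $72$ distinct isotopism classes of partial quasigroup rings of dimensions $1$, $2$ and $3$, respectively. Moreover, in dimension three, writing a partial Latin square of order $3$ row after row with $0$ denoting an empty cell, each of the following nine pairs consists of non-isotopic partial Latin squares whose associated partial quasigroup rings over $\mathbb{F}_2$ are isotopic: (1) $120\ 200\ 000$ and $120\ 210\ 000$; (2) $120\ 200\ 001$ and $120\ 210\ 001$; (3) $120\ 200\ 003$ and $120\ 210\ 003$; (4) $120\ 010\ 300$ and $120\ 210\ 300$; (5) $120\ 013\ 000$ and $123\ 210\ 000$; (6) $120\ 010\ 302$ and $120\ 210\ 301$; (7) $120\ 203\ 001$ and $120\ 213\ 001$; (8) $120\ 013\ 300$ and $120\ 213\ 300$; (9) $120\ 013\ 302$ and $123\ 210\ 301$.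
   Context: An algebra over a field $\mathbb{K}$ is a $\mathbb{K}$-vector space with a bilinear multiplication (not assumed associative, commutative or unital). Two algebras $A,A'$ over $\mathbb{K}$ are isotopic if there are three non-singular linear maps $f,g,h:A\to A'$ with $f(u)g(v)=h(uv)$ for all $u,v\in A$. A partial Latin square of order $n$ is an $n\times n$ array in which each cell is either empty or contains an element of $[n]=\{1,\ldots,n\}$, each symbol occurring at most once in each row and at most once in each column. It is the multiplication table of a partial quasigroup $([n],\cdot)$, where $i\cdot j$ is the entry of cell $(i,j)$ if that cell is non-empty and is undefined otherwise. Two partial Latin squares of order $n$ are isotopic if one is obtained from the other by a permutation of rows, a permutation of columns and a permutation of symbols. The partial quasigroup ring over $\mathbb{K}$ based on $([n],\cdot)$ is the $n$-dimensional algebra with basis $\{e_1,\ldots,e_n\}$ and $e_ie_j=e_{i\cdot j}$ if $i\cdot j$ is defined, $e_ie_j=0$ otherwise. The isotopism classes counted are those of the set of all $n$-dimensional partial quasigroup rings over $\mathbb{F}_2$. *)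

(* Defs.v *)
From HB Require Import structures.
From mathcomp Require Import all_boot all_order all_fingroup all_algebra.
From mathcomp Require Import boolp.

Set Implicit Arguments.
Unset Strict Implicit.
Unset Printing Implicit Defensive.

Import GRing.Theory.
Local Open Scope ring_scope.

(* MathComp's own algebra structures are associative and unital, hence this
   record. *)
Record algebra (K : fieldType) := MkAlgebra {
  alg_space :> lmodType K;
  alg_mul : {bilinear alg_space -> alg_space -> alg_space}
}.

Definition isotopic (K : fieldType) (A A' : algebra K) : Prop :=
  exists f g h : {linear A -> A'},
    [/\ bijective f, bijective g, bijective h &
        forall u v : A, alg_mul A' (f u) (g v) = h (alg_mul A u v)].

(* An array is a matrix with entries in [option 'I_n], [None] being the empty
   cell; rows, columns and symbols are numbered from 0 to n - 1. *)
Definition partial_latin (n : nat) (P : 'M[option 'I_n]_n) : bool :=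
  [forall i : 'I_n, forall k : 'I_n, (#|[set j | P i j == Some k]| <= 1)%N] &&
  [forall j : 'I_n, forall k : 'I_n, (#|[set i | P i j == Some k]| <= 1)%N].

Definition partial_latin_squares (n : nat) : {set 'M[option 'I_n]_n} :=
  [set P | partial_latin P].

Definition pls_isotopic (n : nat) (P Q : 'M[option 'I_n]_n) : Prop :=
  exists a b c : 'S_n, forall i j, Q (a i) (b j) = omap c (P i j).

Section PartialQuasigroupRing.
Variables (K : fieldType) (n : nat) (P : 'M[option 'I_n]_n).

Definition pq_basis (i : 'I_n) : 'rV[K]_n := delta_mx 0 i.

Definition pq_basis_mul (i j : 'I_n) : 'rV[K]_n :=
  if P i j is Some k then pq_basis k else 0.

Definition pq_mul (u v : 'rV[K]_n) : 'rV[K]_n :=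
  \sum_i \sum_j (u 0 i * v 0 j) *: pq_basis_mul i j.

Lemma pq_mul_bilinear :
  bilinear_for (@GRing.scale K 'rV[K]_n) (@GRing.scale K 'rV[K]_n) pq_mul.
Proof.
split=> [v | u] a x y; rewrite /pq_mul /= scaler_sumr -big_split /=;
  apply: eq_bigr => i _; rewrite scaler_sumr -big_split /=;
  apply: eq_bigr => j _; rewrite !mxE scalerA -scalerDl.
  by rewrite mulrDl mulrA.
by rewrite mulrDr mulrCA.
Qed.

HB.instance Definition _ :=
  bilinear_isBilinear.Build K 'rV[K]_n 'rV[K]_n 'rV[K]_n _ _ pq_mul
    pq_mul_bilinear.

Definition pq_ring : algebra K := @MkAlgebra K 'rV[K]_n pq_mul.

Lemma pq_mulE (i j : 'I_n) :
  pq_mul (pq_basis i) (pq_basis j) =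
  if P i j is Some k then pq_basis k else 0.
Proof.
rewrite /pq_mul (bigD1 i) //= [X in _ + X]big1 => [|i' ne_i]; last first.
  by rewrite big1 // => j' _; rewrite mxE (negbTE ne_i) andbF mul0r scale0r.
rewrite addr0 (bigD1 j) //= big1 => [|j' ne_j]; last first.
  by rewrite [X in _ * X]mxE (negbTE ne_j) andbF mulr0 scale0r.
by rewrite !mxE !eqxx mulr1 scale1r addr0.
Qed.

End PartialQuasigroupRing.

(* Each ring is represented by the partial Latin square it is based on, so a
   class is a set of partial Latin squares. *)
Definition pq_ring_isotopism_classes (K : fieldType) (n : nat) :
    {set {set 'M[option 'I_n]_n}} :=
  equivalence_partition
    (fun P Q => `[< isotopic (pq_ring K P) (pq_ring K Q) >])
    (partial_latin_squares n).

(* The array written row after row in [s], where the digit 0 is an empty cell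
   and the digit d > 0 is the symbol numbered d - 1. *)
Definition array_of_digits (n : nat) (s : seq nat) : 'M[option 'I_n]_n :=
  \matrix_(i < n, j < n)
    if nth 0%N s (i * n + j) is d.+1 then insub d else None.

Lemma isotopic_refl (K : fieldType) (A : algebra K) : isotopic A A.
Proof. by exists idfun, idfun, idfun; split=> //; exists id. Qed.

Lemma linear_inv (K : fieldType) (U V : lmodType K) (f : {linear U -> V}) :
  bijective f -> exists f' : {linear V -> U}, cancel f f' /\ cancel f' f.
Proof.
case=> g fK gK.
have g_linear : linear g by move=> a x y; apply: (can_inj fK); rewrite linearP !gK.
pose g' := HB.pack_for {linear V -> U} g (GRing.isLinear.Build K V U _ g g_linear).
by exists g'.
Qed.

Lemma isotopic_sym (K : fieldType) (A A' : algebra K) :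
  isotopic A A' -> isotopic A' A.
Proof.
case=> f [g [h [/linear_inv[f' [fK f'K]] /linear_inv[g' [gK g'K]]]]].
case/linear_inv=> h' [hK h'K] fgh; exists f', g', h'.
split; [by exists f | by exists g | by exists h | move=> u v].
by rewrite -[LHS]hK -fgh f'K g'K.
Qed.

Lemma isotopic_trans (K : fieldType) (A B C : algebra K) :
  isotopic A B -> isotopic B C -> isotopic A C.
Proof.
case=> f [g [h [bf bg bh fgh]]] [f' [g' [h' [bf' bg' bh' fgh']]]].
exists (f' \o f), (g' \o g), (h' \o h); split; try exact: bij_comp.
by move=> u v /=; rewrite fgh' fgh.
Qed.

(* Main.v *)
Require Import Defs.
From mathcomp Require Import all_boot all_order all_fingroup all_algebra.
From mathcomp Require Import boolp.

Set Implicit Arguments.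
Unset Strict Implicit.
Unset Printing Implicit Defensive.

Import GRing.Theory.
Local Open Scope nat_scope.

(** The classes are counted by exhibiting a list of representatives that is
complete up to isotopism of rings and on which an isotopism invariant is
injective.

Completeness. Isotopic arrays have isotopic rings ([isotopic_pls_ring]:
permute the basis vectors). The partial Latin squares up to isotopy are
generated by filling one cell at a time: removing a cell from a partial Latin
square leaves a partial Latin square, so each one with k + 1 filled cells is
isotopic to a one-cell extension of a representative with k filled cells
([pls_reps_cover]). This gives 2, 8 and 81 arrays of orders 1, 2 and 3. Some of
them have isotopic rings: one pair in order 2 and the nine pairs of the theorem
in order 3. In the simplest case the two rings are, up to a zero summand,
K[x]/(x^2) and the group ring of the cyclic group of order 2, which are
isomorphic in characteristic 2 through x |-> 1 + g. The
other pairs are likewise related by linear maps that fix e_3 and preserve the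
span of e_1 and e_2; explicit triples of such maps are verified on all pairs of
vectors ([isotopic_bit_isotopism]). Dropping one array of each pair leaves 2, 7
and 72 representatives.

Separation. An isotopism of rings is in particular a relabelling of the rows,
of the columns and of the entries of the multiplication table of the whole
finite ring, with 2^n rows and columns. Counting two configurations row by row
in that table gives the invariant [row_profile]: how often an entry of the row
recurs in the columns, and in how many intercalates (2 x 2 subsquares, possibly
degenerate) the row takes part. The representatives have pairwise different
invariants, by computation ([classifies3]).

The two arrays of each of the nine pairs are not isotopic because they have
different numbers of filled cells. *)

(** * Counting equivalence classes *)

Lemma uniq_map_inj (T X : eqType) (f : T -> X) (s : seq T) :
  uniq (map f s) -> {in s &, injective f}.
Proof.
elim: s => //= z s IH /andP[fz_notin /IH inj_f] x y; rewrite !inE.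
case/predU1P=> [->|xs] /predU1P[->|ys] // fxy; last exact: inj_f.
  by case/negP: fz_notin; rewrite fxy map_f.
by case/negP: fz_notin; rewrite -fxy map_f.
Qed.

(** The listed representatives meet every class, and [inv] shows that they lie in
different ones. *)
Lemma card_equivalence_partition (T : finType) (X : eqType) (R : rel T)
    (D : {set T}) (inv : T -> X) (reps : seq T) :
  {in D & &, equivalence_rel R} ->
  {subset reps <= D} ->
  {in D &, forall x y, R x y -> inv x = inv y} ->
  uniq (map inv reps) ->
  {in D, forall x, exists2 y, y \in reps & R x y} ->
  #|equivalence_partition R D| = size reps.
Proof.
move=> eqR sub_reps invR uniq_inv cover.
pose cls x := [set y in D | R x y].
have refl x : x \in D -> R x x by move=> Dx; have [] := eqR x x x Dx Dx Dx.
have -> : equivalence_partition R D = [set:: map cls reps].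
  apply/setP=> B; rewrite inE; apply/imsetP/mapP=> -[x x_in ->]; last first.
    by exists x => //; apply: sub_reps.
  have [y y_in Rxy] := cover x x_in; exists y => //.
  apply/setP=> z; rewrite !inE; case: (boolP (z \in D)) => //= Dz.
  by have [_ ->] := eqR x y z x_in (sub_reps y y_in) Dz.
rewrite cardsE (card_uniqP _) ?size_map // map_inj_in_uniq.
  exact: map_uniq uniq_inv.
move=> x y x_in y_in eq_cls.
have Rxy : R x y.
  have : y \in cls y by rewrite inE sub_reps ?refl // sub_reps.
  by rewrite -eq_cls inE => /andP[].
apply: (uniq_map_inj uniq_inv x_in y_in).
exact: invR (sub_reps _ x_in) (sub_reps _ y_in) Rxy.
Qed.

(** * Isotopy of partial Latin squares *)

Section PartialLatinSquares.
Variable n : nat.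
Implicit Types P Q : 'M[option 'I_n]_n.

Lemma partial_latinP P :
  reflect ((forall i j j' k, P i j = Some k -> P i j' = Some k -> j = j') /\
           (forall j i i' k, P i j = Some k -> P i' j = Some k -> i = i'))
          (partial_latin P).
Proof.
apply: (iffP andP) => -[row_inj col_inj]; split.
- move=> i j j' k Pij Pij'; apply/eqP; have /forallP/(_ k) := forallP row_inj i.
  by move/card_le1_eqP => /(_ j j'); rewrite !inE Pij Pij' eqxx => ->.
- move=> j i i' k Pij Pij'; apply/eqP; have /forallP/(_ k) := forallP col_inj j.
  by move/card_le1_eqP => /(_ i i'); rewrite !inE Pij Pij' eqxx => ->.
- apply/forallP=> i; apply/forallP=> k; apply/card_le1_eqP => j j'.
  by rewrite !inE => /eqP Pij /eqP Pij'; exact/esym/(row_inj _ _ _ _ Pij Pij').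
- apply/forallP=> j; apply/forallP=> k; apply/card_le1_eqP => i i'.
  by rewrite !inE => /eqP Pij /eqP Pij'; exact/esym/(col_inj _ _ _ _ Pij Pij').
Qed.

(** The two uses are an isotopy, where [a], [b] and [c] are permutations, and the
removal of a cell, where they are the identity. *)
Lemma partial_latin_embed P Q (a b c : 'I_n -> 'I_n) :
  injective a -> injective b ->
  (forall i j k, P i j = Some k -> Q (a i) (b j) = Some (c k)) ->
  partial_latin Q -> partial_latin P.
Proof.
move=> a_inj b_inj PQ /partial_latinP[rowQ colQ]; apply/partial_latinP.
split=> [i j j' k /PQ Qij /PQ Qij' | j i i' k /PQ Qij /PQ Qij'].
  exact/b_inj/(rowQ _ _ _ _ Qij Qij').
exact/a_inj/(colQ _ _ _ _ Qij Qij').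
Qed.

Lemma pls_isotopic_refl P : pls_isotopic P P.
Proof.
exists 1%g, 1%g, 1%g => i j; rewrite !perm1.
by case: (P i j) => [k|] //=; rewrite perm1.
Qed.

Lemma pls_isotopic_sym P Q : pls_isotopic P Q -> pls_isotopic Q P.
Proof.
case=> a [b [c PQ]]; exists a^-1%g, b^-1%g, c^-1%g => i j.
by rewrite -{2}(permKV a i) -{2}(permKV b j) PQ; case: (P _ _) => [k|] //=; rewrite permK.
Qed.

Lemma pls_isotopic_trans P Q S :
  pls_isotopic P Q -> pls_isotopic Q S -> pls_isotopic P S.
Proof.
case=> a [b [c PQ]] [a' [b' [c' QS]]]; exists (a * a')%g, (b * b')%g, (c * c')%g.
by move=> i j; rewrite !permM QS PQ; case: (P i j) => [k|] //=; rewrite permM.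
Qed.

Definition filled P := [set ij | isSome (P ij.1 ij.2)].

Lemma pls_isotopic_card_filled P Q : pls_isotopic P Q -> #|filled P| = #|filled Q|.
Proof.
case=> a [b [c PQ]].
have ab_inj : injective (fun ij : 'I_n * 'I_n => (a ij.1, b ij.2)).
  by case=> i j [i' j'] [/perm_inj-> /perm_inj->].
rewrite -[RHS](card_preimset _ ab_inj); apply: eq_card => -[i j].
by rewrite !inE /= PQ; case: (P i j).
Qed.

(** The permutations of rows, columns and symbols act on the basis, and the maps
they induce form the isotopism. *)
Lemma isotopic_pls_ring (K : fieldType) P Q :
  pls_isotopic P Q -> isotopic (pq_ring K P) (pq_ring K Q).
Proof.
case=> a [b [c PQ]].
pose move (s : 'S_n) : {linear 'rV[K]_n -> 'rV[K]_n} := col_perm s^-1%g.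
have move_bij s : bijective (move s).
  exists (col_perm s) => u; rewrite /= -col_permM ?mulgV ?mulVg;
    by apply/matrixP=> i j; rewrite mxE perm1.
have move_basis s i : move s (pq_basis K i) = pq_basis K (s i).
  by apply/rowP=> j; rewrite !mxE eqxx /= (canF_eq (permK s^-1%g)) invgK.
exists (move a), (move b), (move c); split=> // u v.
change (pq_mul Q (move a u) (move b v) = move c (pq_mul P u v)).
rewrite /pq_mul linear_sum (reindex_inj (@perm_inj _ a)); apply: eq_bigr => i _.
rewrite linear_sum (reindex_inj (@perm_inj _ b)); apply: eq_bigr => j _.
rewrite linearZ /= !mxE !permK; congr (_ *: _)%R.
rewrite /pq_basis_mul PQ; case: (P i j) => [k|] /=; last by rewrite linear0.
by rewrite -/(move c _) move_basis.
Qed.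

End PartialLatinSquares.

(** * Arrays given by their digits *)

Definition digit (n : nat) (s : seq nat) (i j : nat) : nat :=
  nth 0 s (i * n + j).

Definition symbol (n d : nat) : option 'I_n := if d is k.+1 then insub k else None.

Lemma array_of_digitsE n s (i j : 'I_n) :
  array_of_digits n s i j = symbol n (digit n s i j).
Proof. by rewrite mxE. Qed.

Lemma symbol_eq_Some n d (k : 'I_n) : (symbol n d == Some k) = (d == k.+1).
Proof.
case: d => [|d] //=; rewrite eqSS; case: insubP => [l _ <- //|].
by rewrite -leqNgt => le_nd; rewrite gtn_eqF // (leq_trans (ltn_ord k)).
Qed.

Lemma isSome_symbol n d : isSome (symbol n d) = (0 < d <= n).
Proof. by case: d => //= d; case: insubP => [? ->|/negbTE->]. Qed.

Lemma big_iota_ord (R : Type) (idx : R) (op : R -> R -> R) n (p : pred nat) (F : nat -> R) :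
  \big[op/idx]_(i <- iota 0 n | p i) F i = \big[op/idx]_(i < n | p i) F i.
Proof. by rewrite -{1}[n]subn0 -/(index_iota 0 n) big_mkord. Qed.

Lemma card_set_ord n (p : pred nat) : #|[set i : 'I_n | p i]| = count p (iota 0 n).
Proof. by rewrite -sum1dep_card -sum1_count big_iota_ord. Qed.

Definition latin_digits (n : nat) (s : seq nat) : bool :=
  all (fun i => all (fun k =>
    (count (fun j => digit n s i j == k.+1) (iota 0 n) <= 1) &&
    (count (fun j => digit n s j i == k.+1) (iota 0 n) <= 1))
  (iota 0 n)) (iota 0 n).

Lemma latin_digitsE n s : latin_digits n s = partial_latin (array_of_digits n s).
Proof.
have all_ord (p : pred nat) : all p (iota 0 n) = [forall i : 'I_n, p i].
  apply/allP/forallP=> [p_all i | p_all i]; first by apply: p_all; rewrite mem_iota ltn_ord.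
  by rewrite mem_iota => lt_i; apply: (p_all (Ordinal lt_i)).
have row_count (i k : 'I_n) : #|[set j | array_of_digits n s i j == Some k]| =
    count (fun j => digit n s i j == k.+1) (iota 0 n).
  rewrite -card_set_ord; apply: eq_card => j.
  by rewrite !inE array_of_digitsE symbol_eq_Some.
have col_count (j k : 'I_n) : #|[set i | array_of_digits n s i j == Some k]| =
    count (fun i => digit n s i j == k.+1) (iota 0 n).
  rewrite -card_set_ord; apply: eq_card => i.
  by rewrite !inE array_of_digitsE symbol_eq_Some.
rewrite /latin_digits all_ord; apply/forallP/andP => [L | [/forallP rowL /forallP colL]].
  split; apply/forallP=> i; apply/forallP=> k; have := L i;
    rewrite all_ord => /forallP/(_ k)/andP[].
    by rewrite row_count.
  by rewrite col_count.
move=> i; rewrite all_ord; apply/forallP=> k; rewrite -row_count -col_count.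
by rewrite (forallP (rowL i)) (forallP (colL i)).
Qed.

Definition count_cells (n : nat) (s : seq nat) : nat :=
  sumn [seq count (fun j => 0 < digit n s i j <= n) (iota 0 n) | i <- iota 0 n].

Lemma card_filled_digits n s : #|filled (array_of_digits n s)| = count_cells n s.
Proof.
rewrite /count_cells sumnE big_map big_iota_ord.
rewrite -sum1dep_card (eq_bigr (fun i : 'I_n => \sum_(j < n | 0 < digit n s i j <= n) 1)).
  rewrite pair_big_dep; apply: eq_bigl => -[i j] /=.
  by rewrite array_of_digitsE isSome_symbol.
by move=> i _; rewrite -card_set_ord -sum1dep_card. 
Qed.

Definition digits_of (n : nat) (d : nat -> nat -> nat) : seq nat :=
  mkseq (fun c => d (c %/ n) (c %% n)) (n * n).

Lemma cell_lt n (i j : 'I_n) : i * n + j < n * n.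
Proof.
apply: (@leq_trans (i.+1 * n)); last by rewrite leq_mul2r ltn_ord orbT.
by rewrite mulSn addnC ltn_add2r.
Qed.

Lemma digit_digits_of n d (i j : 'I_n) : digit n (digits_of n d) i j = d i j.
Proof.
have n_gt0 : 0 < n by apply: leq_ltn_trans (ltn_ord i).
by rewrite /digit nth_mkseq ?cell_lt // divnMDl // modnMDl divn_small // modn_small // addn0.
Qed.

(** * Generation of the partial Latin squares up to isotopy *)

Definition permuted (n : nat) (s : seq nat) (ab : seq nat * seq nat) : seq nat :=
  digits_of n (fun i j => digit n s (nth 0 ab.1 i) (nth 0 ab.2 j)).

(** All symbols, in the order in which they first occur in [s]; those that do not
occur come last. The reversals are there because [undup] keeps the last
occurrence. *)
Definition symbol_order (n : nat) (s : seq nat) : seq nat :=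
  rev (undup (rev ([seq k <- s | 0 < k <= n] ++ iota 1 n))).

Definition relabel (n : nat) (s : seq nat) : seq nat :=
  [seq (if k == 0 then 0 else (index k (symbol_order n s)).+1) | k <- s].

Fixpoint lexicographic_leq (s t : seq nat) : bool :=
  match s, t with
  | x :: s', y :: t' => (x < y) || (x == y) && lexicographic_leq s' t'
  | _, _ => true
  end.

(** The lexicographically largest array obtained by permuting rows and columns
and then numbering the symbols by first occurrence. Isotopic arrays have the same
normal form, which keeps the list of representatives free of repetitions. *)
Definition normal_form (n : nat) (s : seq nat) : seq nat :=
  let ps := permutations (iota 0 n) in
  foldr (fun t best => if lexicographic_leq best t then t else best) (relabel n s)
    [seq relabel n (permuted n s (a, b)) | a <- ps, b <- ps].

Lemma perm_of_nat_fun n (f : nat -> nat) :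
  (forall i, i < n -> f i < n) -> {in gtn n &, injective f} ->
  exists p : 'S_n, forall i : 'I_n, p i = f i :> nat.
Proof.
move=> f_lt f_inj; pose g (i : 'I_n) := Ordinal (f_lt i (ltn_ord i)).
have g_inj : injective g by move=> i j [/f_inj eq_ij]; apply/val_inj/eq_ij; rewrite inE.
by exists (perm g_inj) => i; rewrite permE.
Qed.

Lemma perm_of_seq n (a : seq nat) : a \in permutations (iota 0 n) ->
  exists p : 'S_n, forall i : 'I_n, p i = nth 0 a i :> nat.
Proof.
rewrite mem_permutations => a_perm.
have size_a : size a = n by rewrite (perm_size a_perm) size_iota.
apply: perm_of_nat_fun => [i lt_i | i j]; last first.
  rewrite !inE => lt_i lt_j /eqP; rewrite nth_uniq ?size_a //; first by move/eqP.
  by rewrite (perm_uniq a_perm) iota_uniq.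
by have := mem_nth 0 (_ : i < size a); rewrite (perm_mem a_perm) mem_iota size_a; apply.
Qed.

Lemma perm_symbol_order n s : perm_eq (symbol_order n s) (iota 1 n).
Proof.
apply: uniq_perm; rewrite ?iota_uniq ?rev_uniq ?undup_uniq // => k.
rewrite mem_rev mem_undup mem_rev mem_cat mem_filter mem_iota add1n ltnS.
by case: (0 < k <= n); rewrite /= ?orbT.
Qed.

Lemma relabel_isotopic n s :
  pls_isotopic (array_of_digits n s) (array_of_digits n (relabel n s)).
Proof.
have o_perm := perm_symbol_order n s; set o := symbol_order n s in o_perm.
have mem_o k : k < n -> k.+1 \in o by rewrite (perm_mem o_perm) mem_iota add1n ltnS.
have size_o : size o = n by rewrite (perm_size o_perm) size_iota.
have [k lt_k | k l | c cE] := @perm_of_nat_fun n (fun k => index k.+1 o).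
- by rewrite -[X in _ < X]size_o index_mem mem_o.
- rewrite !inE => /mem_o ko /mem_o lo eq_i.
  by apply: succn_inj; rewrite -(nth_index 0 ko) -(nth_index 0 lo) eq_i.
exists 1%g, 1%g, c => i j; rewrite !perm1 !array_of_digitsE.
have -> : digit n (relabel n s) i j =
    if digit n s i j == 0 then 0 else (index (digit n s i j) o).+1.
  rewrite /digit /relabel; have [lt_c|le_c] := ltnP (i * n + j) (size s).
    by rewrite (nth_map 0).
  by rewrite [in RHS]nth_default // nth_default // size_map.
case: (digit n s i j) => [|k] //=; case: (insubP _ k) => [l lt_k lE | ge_k] /=.
  by apply/eqP; rewrite (symbol_eq_Some (index k.+1 o).+1) cE lE.
rewrite insubN // -leqNgt -size_o leqNgt index_mem (perm_mem o_perm) mem_iota.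
by rewrite add1n !ltnS.
Qed.

Lemma normal_form_isotopic n s :
  pls_isotopic (array_of_digits n s) (array_of_digits n (normal_form n s)).
Proof.
have: {in [seq relabel n (permuted n s (a, b)) |
             a <- permutations (iota 0 n), b <- permutations (iota 0 n)],
       forall t, pls_isotopic (array_of_digits n s) (array_of_digits n t)}.
  move=> _ /allpairsP[[a b] /= [/perm_of_seq[p pE] /perm_of_seq[q qE] ->]].
  apply: pls_isotopic_trans (relabel_isotopic _ _); apply: pls_isotopic_sym.
  exists p, q, 1%g => i j; rewrite !array_of_digitsE digit_digits_of /= -pE -qE.
  by case: symbol => [k|] //=; rewrite perm1.
rewrite /normal_form; elim: [seq _ | _ <- _, _ <- _] => [_ | t l IH isoP] /=.
  exact: relabel_isotopic.
case: ifP => _; first by apply: isoP; rewrite mem_head.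
by apply: IH => x x_in; apply: isoP; rewrite inE x_in orbT.
Qed.

(** A digit that is neither 0 nor the number of a symbol counts as an empty cell,
as in [array_of_digits]. *)
Definition extensions (n : nat) (s : seq nat) : seq (seq nat) :=
  let empty_cells := [seq c <- iota 0 (n * n) | ~~ (0 < nth 0 s c <= n)] in
  [seq t <- [seq set_nth 0 s c k | c <- empty_cells, k <- iota 1 n] |
     latin_digits n t].

Definition pls_reps_step (n : nat) (l : seq (seq nat)) : seq (seq nat) :=
  undup [seq normal_form n t | t <- flatten (map (extensions n) l)].

Definition pls_reps (n : nat) : seq (seq nat) :=
  flatten (traject (pls_reps_step n) [:: nseq (n * n) 0] (n * n).+1).

(** Induction on the number of filled cells: remove one cell of [P], transport it
along an isotopy from the rest of [P] to a representative [s], and add it to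
[s]. *)
Lemma pls_reps_level n k (P : 'M[option 'I_n]_n) :
  partial_latin P -> #|filled P| = k ->
  exists2 s, s \in iter k (pls_reps_step n) [:: nseq (n * n) 0] &
    pls_isotopic P (array_of_digits n s).
Proof.
elim: k P => [|k IH] P latinP cardP.
  exists (nseq (n * n) 0); first by rewrite mem_head.
  exists 1%g, 1%g, 1%g => i j; rewrite !perm1 array_of_digitsE /digit nth_nseq if_same /=.
  have /negbT := in_set0 (i, j); rewrite -(cards0_eq cardP) inE /=.
  by case: (P i j).
have /card_gt0P[[i j]] : 0 < #|filled P| by rewrite cardP.
rewrite inE /=; case Pij: (P i j) => [k0|] // _.
pose P' : 'M[option 'I_n]_n :=
  (\matrix_(i', j') if (i' == i) && (j' == j) then None else P i' j')%R.
have latinP' : partial_latin P'.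
  apply: (@partial_latin_embed _ P' P id id id) => // i' j' l.
  by rewrite mxE; case: ifP.
have /IH : #|filled P'| = k; last move=> /(_ latinP') [s s_in [a [b [c P's]]]].
  apply: succn_inj; rewrite -cardP [in RHS](cardsD1 (i, j)) inE /= Pij add1n.
  congr _.+1; apply: eq_card => -[i' j']; rewrite !inE mxE /= xpair_eqE.
  by case: ifP.
(* The removed cell, transported to row a i, column b j and symbol c k0. *)
pose t := set_nth 0 s (a i * n + b j) (c k0).+1.
have tE i' j' : digit n t (a i') (b j') =
    if (i' == i) && (j' == j) then (c k0).+1 else digit n s (a i') (b j').
  rewrite /digit /t nth_set_nth /=; congr (if _ then _ else _).
  apply/eqP/andP => [eq_c | [/eqP-> /eqP->] //].
  have n_gt0 : 0 < n by apply: leq_ltn_trans (ltn_ord i).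
  move: (congr1 (divn^~ n) eq_c) (congr1 (modn^~ n) eq_c) => /=.
  rewrite !divnMDl // !modnMDl !divn_small // !modn_small // !addn0.
  by move=> /val_inj/perm_inj-> /val_inj/perm_inj->.
have Pt : pls_isotopic P (array_of_digits n t).
  exists a, b, c => i' j'; rewrite array_of_digitsE tE.
  case: ifP => [/andP[/eqP-> /eqP->] | ne_ij].
    by rewrite Pij; apply/eqP; rewrite symbol_eq_Some.
  by rewrite -array_of_digitsE P's mxE ne_ij.
exists (normal_form n t); last exact: pls_isotopic_trans Pt (normal_form_isotopic n t).
rewrite /= mem_undup; apply/map_f/flatten_mapP; exists s => //.
rewrite mem_filter; apply/andP; split.
  have [a' [b' [c' tP]]] := pls_isotopic_sym Pt.
  rewrite latin_digitsE (@partial_latin_embed _ _ P a' b' c') //; try exact: perm_inj.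
  by move=> i' j' l tl; rewrite tP tl.
apply/allpairsP; exists (a i * n + b j, (c k0).+1); split=> //=; last first.
  by rewrite mem_iota add1n !ltnS ltn_ord.
rewrite mem_filter mem_iota /= add0n -isSome_symbol -/(digit n s _ _).
by rewrite -array_of_digitsE P's mxE !eqxx /= cell_lt.
Qed.

Lemma pls_reps_cover n (P : 'M[option 'I_n]_n) : partial_latin P ->
  exists2 s, s \in pls_reps n & pls_isotopic P (array_of_digits n s).
Proof.
move=> latinP; have [s s_in Ps] := pls_reps_level latinP (erefl _).
exists s => //; apply/flattenP.
exists (iter #|filled P| (pls_reps_step n) [:: nseq (n * n) 0]) => //.
apply/trajectP; exists #|filled P| => //; rewrite ltnS.
by rewrite -[X in _ <= X * X]card_ord -card_prod max_card.
Qed.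

(** * An invariant of multiplication tables *)

Section RowProfile.
Variables (T : eqType) (e : seq T) (m : T -> T -> T).

Definition column (v : T) : seq T := [seq m u v | u <- e].

(** The pairs of a cell of the row [u] and a column that contains the entry of
that cell. *)
Definition shared_entries (u : T) : nat :=
  sumn [seq count (fun v' => m u v \in column v') e | v <- e].

(** The 2 x 2 subarrays, one of whose rows is [u], with equal entries on each of
the two diagonals. Without these counts, [1 2 3 / 3 1 0 / 2 0 1] and
[1 2 3 / 3 1 2 / 2 3 0] would not be separated in order 3. *)
Definition intercalates (u : T) : nat :=
  sumn [seq sumn [seq count (fun v' => (m u v == m u' v') && (m u v' == m u' v)) e
                 | v <- e] | u' <- e].

Definition row_profile : seq nat * seq nat :=
  (sort leq (map shared_entries e), sort leq (map intercalates e)).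

End RowProfile.

(** Only equalities between entries are counted, so an injective relabelling [h]
of the entries preserves the counts. Sorting removes the dependence on the order
of the rows. Beside invariance, this transfers the table of a ring to a table of
numbers. *)
Lemma row_profile_isotopism (T T' : eqType) (e : seq T) (e' : seq T')
    (m : T -> T -> T) (m' : T' -> T' -> T') (f g h : T -> T') :
  injective h -> perm_eq e' (map f e) -> perm_eq e' (map g e) ->
  (forall u v, m' (f u) (g v) = h (m u v)) ->
  row_profile e' m' = row_profile e m.
Proof.
move=> h_inj ef eg fgh.
have sum_by k F : perm_eq e' (map k e) -> sumn [seq F x | x <- e'] = sumn [seq F (k x) | x <- e].
  by move=> ek; rewrite (perm_sumn (perm_map F ek)) -map_comp.
have count_by k p : perm_eq e' (map k e) -> count p e' = count (p \o k) e.
  by move=> /seq.permP->; rewrite count_map.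
have sharedE u : shared_entries e' m' (f u) = shared_entries e m u.
  rewrite /shared_entries (sum_by g) //; congr sumn; apply: eq_map => v.
  rewrite (count_by g) //; apply: eq_count => v' /=.
  rewrite fgh /column (perm_mem (perm_map _ ef)) -map_comp.
  by rewrite -(mem_map h_inj) -map_comp; congr (_ \in _); apply: eq_map => u'; rewrite /= fgh.
have intercalatesE u : intercalates e' m' (f u) = intercalates e m u.
  rewrite /intercalates (sum_by f) //; congr sumn; apply: eq_map => u'.
  rewrite (sum_by g) //; congr sumn; apply: eq_map => v.
  rewrite (count_by g) //; apply: eq_count => v' /=.
  by rewrite !fgh !(inj_eq h_inj).
have sort_eq (F' : T' -> nat) (F : T -> nat) : (forall u, F' (f u) = F u) ->
    sort leq (map F' e') = sort leq (map F e).
  move=> F'E; rewrite -(eq_map F'E) (map_comp F' f).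
  exact/(perm_sortP leq_total leq_trans anti_leq)/perm_map.
by rewrite /row_profile (sort_eq _ _ sharedE) (sort_eq _ _ intercalatesE).
Qed.

Definition ring_profile (K : finFieldType) n (P : 'M[option 'I_n]_n) :=
  row_profile (enum {: 'rV[K]_n}) (@pq_mul K n P).

Lemma ring_profile_isotopic (K : finFieldType) n (P Q : 'M[option 'I_n]_n) :
  isotopic (pq_ring K P) (pq_ring K Q) -> ring_profile K P = ring_profile K Q.
Proof.
case=> f [g [h [/bij_inj f_inj /bij_inj g_inj /bij_inj h_inj fgh]]].
have enum_map (k : 'rV[K]_n -> 'rV[K]_n) : injective k ->
    perm_eq (enum {: 'rV[K]_n}) (map k (enum {: 'rV[K]_n})).
  move=> k_inj; have e_uniq := enum_uniq {: 'rV[K]_n}.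
  have ke_uniq : uniq (map k (enum {: 'rV[K]_n})) by rewrite map_inj_uniq.
  apply: (uniq_perm e_uniq ke_uniq) => u.
  rewrite mem_enum inE; apply/esym/mapP; exists (invF k_inj u); last by rewrite f_invF.
  by rewrite mem_enum.
exact/esym/(row_profile_isotopism h_inj (enum_map _ f_inj) (enum_map _ g_inj) fgh).
Qed.

(** * Coordinates over the field with two elements *)

Fixpoint bit_vectors (n : nat) : seq bitseq :=
  if n is n'.+1 then [seq b :: s | b <- [:: false; true], s <- bit_vectors n']
  else [:: [::]].

Lemma size_bit_vectors n : size (bit_vectors n) = 2 ^ n.
Proof. by elim: n => //= n IH; rewrite cats0 size_cat !size_map IH addnn -mul2n expnS. Qed.

Lemma mem_bit_vectors n s : (s \in bit_vectors n) = (size s == n).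
Proof.
elim: n s => [|n IH] s; first by rewrite inE size_eq0.
apply/allpairsP/idP => [[[b t] /= [_]] | ].
  by rewrite IH => /eqP<- ->.
by case: s => [|b s] //=; rewrite eqSS -IH => s_in; exists (b, s); split=> //; case: b.
Qed.

Definition parity (n : nat) (F : nat -> bool) : bool := foldr addb false (mkseq F n).

Lemma natr_parity n F : ((parity n F)%:R = \sum_(i < n) (F i)%:R :> 'F_2)%R.
Proof.
rewrite /parity foldrE big_map big_iota_ord.
by apply: (big_morph (fun b : bool => b%:R : 'F_2)%R) => // -[] [] //; apply/eqP.
Qed.

Lemma F2_natr_bool (x : 'F_2) : x = ((x != 0)%:R)%R.
Proof. by case: x => -[|[|k]] lt_k //; apply/val_inj. Qed.

Lemma F2_bool_neq0 (b : bool) : ((b%:R : 'F_2) != 0)%R = b.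
Proof. by case: b. Qed.

Definition bits n (u : 'rV['F_2]_n) : bitseq := [seq (u 0 i != 0)%R | i <- enum 'I_n].

Lemma size_bits n (u : 'rV['F_2]_n) : size (bits u) = n.
Proof. by rewrite size_map size_enum_ord. Qed.

Lemma nth_bits n (u : 'rV['F_2]_n) (i : 'I_n) : nth false (bits u) i = (u 0 i != 0)%R.
Proof. by rewrite (nth_map i) ?size_enum_ord // nth_ord_enum. Qed.

Lemma bits_inj n : injective (@bits n).
Proof.
move=> u v eq_uv; apply/rowP=> i; rewrite [LHS]F2_natr_bool [RHS]F2_natr_bool.
by rewrite -!nth_bits eq_uv.
Qed.

Lemma bits_in n (u : 'rV['F_2]_n) : bits u \in bit_vectors n.
Proof. by rewrite mem_bit_vectors size_bits. Qed.

Lemma bitsP n (u : 'rV['F_2]_n) (F : nat -> bool) :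
  (forall i : 'I_n, u 0 i = (F i)%:R)%R -> bits u = mkseq F n.
Proof.
move=> uE; apply: (@eq_from_nth _ false); rewrite size_bits ?size_mkseq // => i lt_i.
by rewrite nth_mkseq // (nth_bits u (Ordinal lt_i)) uE F2_bool_neq0.
Qed.

Definition bit_mul (n : nat) (s : seq nat) (u v : bitseq) : bitseq :=
  mkseq (fun k => parity n (fun i => parity n (fun j =>
    [&& nth false u i, nth false v j & digit n s i j == k.+1]))) n.

Lemma bits_pq_mul n s (u v : 'rV['F_2]_n) :
  bits (pq_mul (array_of_digits n s) u v) = bit_mul n s (bits u) (bits v).
Proof.
apply: bitsP => k; rewrite natr_parity summxE; apply: eq_bigr => i _.
rewrite natr_parity summxE; apply: eq_bigr => j _.
rewrite !nth_bits -symbol_eq_Some -array_of_digitsE /pq_basis_mul mxE.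
rewrite [in LHS](F2_natr_bool (u 0 i)%R) [in LHS](F2_natr_bool (v 0 j)%R).
case: (_ != _)%R => /=; last by rewrite !mul0r.
case: (_ != _)%R => /=; last by rewrite mulr0 mul0r.
rewrite !mul1r; case: (array_of_digits n s i j) => [l|]; last by rewrite mxE.
by rewrite mxE /= (eq_sym k).
Qed.

(** Linear maps are given by the supports of the images of the basis vectors,
with the numbering from 1 of the digits of the arrays: [[:: [:: 1]; [:: 1; 2]]]
maps e_1 to e_1 and e_2 to e_1 + e_2. *)
Definition bit_map (n : nat) (F : seq (seq nat)) (u : bitseq) : bitseq :=
  mkseq (fun k => parity n (fun i => nth false u i && (k.+1 \in nth [::] F i))) n.

Definition support_mx (n : nat) (F : seq (seq nat)) : 'M['F_2]_n :=
  (\matrix_(i, k) (k.+1 \in nth [::] F i)%:R)%R.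

Lemma bits_mulmx n F (u : 'rV['F_2]_n) : bits (u *m support_mx n F)%R = bit_map n F (bits u).
Proof.
apply: bitsP => k; rewrite natr_parity mxE; apply: eq_bigr => i _.
by rewrite nth_bits mxE [in LHS](F2_natr_bool (u 0 i)%R) -natrM mulnb.
Qed.

(** Linear maps are bijective here as soon as they take different values on the
finitely many vectors, and the identity f(u) g(v) = h(uv) is tested on all of
them. *)
Definition is_bit_isotopism (n : nat) (s t : seq nat) (F G H : seq (seq nat)) : bool :=
  let B := bit_vectors n in
  [&& all (fun M => uniq (map (bit_map n M) B)) [:: F; G; H] &
      all (fun u => all (fun v =>
        bit_mul n t (bit_map n F u) (bit_map n G v) == bit_map n H (bit_mul n s u v)) B) B].

Lemma isotopic_bit_isotopism n s t F G H : is_bit_isotopism n s t F G H ->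
  isotopic (pq_ring 'F_2 (array_of_digits n s)) (pq_ring 'F_2 (array_of_digits n t)).
Proof.
case/andP=> /allP uniqM /allP isoB.
pose lin M : {linear 'rV['F_2]_n -> 'rV['F_2]_n} := mulmxr (support_mx n M).
have lin_bij M : M \in [:: F; G; H] -> bijective (lin M).
  move=> /uniqM/uniq_map_inj M_inj; apply: injF_bij => u v eq_uv.
  apply: bits_inj; apply: M_inj; rewrite ?bits_in //.
  by rewrite -!bits_mulmx; congr bits.
exists (lin F), (lin G), (lin H).
split; try by apply: lin_bij; rewrite !inE eqxx ?orbT.
move=> u v; apply: bits_inj.
rewrite [LHS]bits_pq_mul [in RHS]/lin [RHS]bits_mulmx !bits_mulmx bits_pq_mul.
exact/eqP/(allP (isoB _ (bits_in u)))/bits_in.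
Qed.

(** The vectors are replaced by their ranks in [bit_vectors], so that the products
are computed once and [row_profile] only compares small numbers. *)
Definition bit_table (n : nat) (s : seq nat) : seq (seq nat) :=
  let B := bit_vectors n in [seq [seq index (bit_mul n s u v) B | v <- B] | u <- B].

Definition digits_profile (n : nat) (s : seq nat) : seq nat * seq nat :=
  let t := bit_table n s in
  row_profile (iota 0 (2 ^ n)) (fun a b => nth 0 (nth [::] t a) b).

Lemma ring_profile_digits n s : ring_profile 'F_2 (array_of_digits n s) = digits_profile n s.
Proof.
pose num (u : 'rV['F_2]_n) := index (bits u) (bit_vectors n).
have num_inj : injective num.
  move=> u v eq_uv; apply: bits_inj.
  by rewrite -(nth_index [::] (bits_in u)) -(nth_index [::] (bits_in v)) -/(num u) eq_uv.
have num_lt u : num u < 2 ^ n by rewrite -size_bit_vectors index_mem bits_in.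
have num_perm : perm_eq (iota 0 (2 ^ n)) (map num (enum {: 'rV['F_2]_n})).
  have num_uniq : uniq (map num (enum {: 'rV['F_2]_n})) by rewrite map_inj_uniq ?enum_uniq.
  rewrite perm_sym; apply: uniq_perm; rewrite ?iota_uniq //.
  apply: (uniq_min_size num_uniq _ _).2 => [_ /mapP[u _ ->]|].
    by rewrite mem_iota num_lt.
  by rewrite size_iota size_map -cardE card_mx card_Fp // mul1n.
apply/esym; apply: row_profile_isotopism num_inj num_perm (num_perm) _ => u v.
rewrite /bit_table (nth_map [::]) ?size_bit_vectors // (nth_map [::]) ?size_bit_vectors //.
by rewrite !nth_index ?bits_in // -bits_pq_mul.
Qed.

(** * Classification and count *)

(** Two arrays and a triple of linear maps, an isotopism from the ring of the
first array to that of the second. *)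
Definition coincidence : Type :=
  (seq nat * seq nat) * (seq (seq nat) * seq (seq nat) * seq (seq nat)).

Definition is_coincidence (n : nat) (c : coincidence) : bool :=
  let: (s, t, (F, G, H)) := c in is_bit_isotopism n s t F G H.

Lemma is_coincidence_isotopic n c : is_coincidence n c ->
  isotopic (pq_ring 'F_2 (array_of_digits n c.1.1)) (pq_ring 'F_2 (array_of_digits n c.1.2)).
Proof. by case: c => -[s t] [[F G] H]; apply: isotopic_bit_isotopism. Qed.

Definition ring_reps (n : nat) (C : seq coincidence) : seq (seq nat) :=
  [seq r <- pls_reps n | r \notin [seq normal_form n c.1.2 | c <- C]].

Definition classifies (n : nat) (C : seq coincidence) (N : nat) : bool :=
  let reps := ring_reps n C in
  [&& size reps == N, all (latin_digits n) reps, uniq (map (digits_profile n) reps) &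
      all (fun c => is_coincidence n c && (normal_form n c.1.1 \in reps)) C].

(** The representatives meet every class: an array is isotopic to an element of
[pls_reps], which is kept or is the normal form of the second array of a
coincidence, and the normal form of the first one is kept. *)
Lemma card_ring_classes n C N : classifies n C N ->
  #|pq_ring_isotopism_classes 'F_2 n| = N.
Proof.
case/and4P=> /eqP<- /allP latin_reps uniq_profiles /allP coincide.
rewrite -(size_map (array_of_digits n)).
apply: (card_equivalence_partition (inv := ring_profile 'F_2 (n := n))).
- move=> P Q S _ _ _; split; first exact/asboolP/isotopic_refl.
  move=> /asboolP PQ; apply/asboolP/asboolP => [PS | QS].
    exact: isotopic_trans (isotopic_sym PQ) PS.
  exact: isotopic_trans PQ QS.
- by move=> _ /mapP[r /latin_reps latin_r ->]; rewrite inE -latin_digitsE.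
- by move=> P Q _ _ /asboolP/ring_profile_isotopic.
- rewrite -map_comp; congr (is_true (uniq _)): uniq_profiles.
  by apply: eq_map => r; rewrite /= ring_profile_digits.
move=> P; rewrite inE => /pls_reps_cover[s s_in /(isotopic_pls_ring 'F_2) Ps].
have [|s_rep] := boolP (s \in [seq normal_form n c.1.2 | c <- C]); last first.
  exists (array_of_digits n s); last exact/asboolP.
  by apply: map_f; rewrite mem_filter s_rep.
case/mapP=> c /coincide/andP[iso_c rep_c] sE; rewrite {}sE in Ps.
exists (array_of_digits n (normal_form n c.1.1)); first exact: map_f.
apply/asboolP; apply: isotopic_trans Ps _.
apply: isotopic_trans (isotopic_pls_ring _ (normal_form_isotopic n c.1.1)).
apply: isotopic_trans (isotopic_sym (is_coincidence_isotopic iso_c)).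
exact/isotopic_sym/isotopic_pls_ring/normal_form_isotopic.
Qed.

(** The rings K[x]/(x^2), with basis 1 and x, and K[g]/(g^2 - 1), with basis 1 and
g: the isomorphism maps x to 1 + g. *)
Definition coincidences2 : seq coincidence :=
  let A := [:: [:: 1]; [:: 1; 2]] in
  [:: (([:: 1;2; 2;0], [:: 1;2; 2;1]), (A, A, A))].

(** All maps fix e_3 and preserve the span of e_1 and e_2. *)
Definition coincidences3 : seq coincidence :=
  let A := [:: [:: 1]; [:: 1; 2]; [:: 3]] in
  let B := [:: [:: 1; 2]; [:: 2]; [:: 3]] in
  let C := [:: [:: 2]; [:: 1; 2]; [:: 3]] in
  let D := [:: [:: 1; 2]; [:: 1]; [:: 3]] in
  [:: (([:: 1;2;0; 2;0;0; 0;0;0], [:: 1;2;0; 2;1;0; 0;0;0]), (A, A, A));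
      (([:: 1;2;0; 2;0;0; 0;0;1], [:: 1;2;0; 2;1;0; 0;0;1]), (A, A, A));
      (([:: 1;2;0; 2;0;0; 0;0;3], [:: 1;2;0; 2;1;0; 0;0;3]), (A, A, A));
      (([:: 1;2;0; 0;1;0; 3;0;0], [:: 1;2;0; 2;1;0; 3;0;0]), (A, B, B));
      (([:: 1;2;0; 0;1;3; 0;0;0], [:: 1;2;3; 2;1;0; 0;0;0]), (C, D, B));
      (([:: 1;2;0; 0;1;0; 3;0;2], [:: 1;2;0; 2;1;0; 3;0;1]), (C, B, D));
      (([:: 1;2;0; 2;0;3; 0;0;1], [:: 1;2;0; 2;1;3; 0;0;1]), (A, A, A));
      (([:: 1;2;0; 0;1;3; 3;0;0], [:: 1;2;0; 2;1;3; 3;0;0]), (A, B, B));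
      (([:: 1;2;0; 0;1;3; 3;0;2], [:: 1;2;3; 2;1;0; 3;0;1]), (C, B, D))].

Lemma classifies1 : classifies 1 [::] 2. Proof. by vm_compute. Qed.
Lemma classifies2 : classifies 2 coincidences2 7. Proof. by vm_compute. Qed.
Lemma classifies3 : classifies 3 coincidences3 72. Proof. by vm_compute. Qed.

Lemma coincidences3_properties :
  all (fun c => [&& latin_digits 3 c.1.1, latin_digits 3 c.1.2,
                    count_cells 3 c.1.1 != count_cells 3 c.1.2 &
                    is_coincidence 3 c]) coincidences3.
Proof. by vm_compute. Qed.

Theorem mainTheorem3 :
  [/\ #|pq_ring_isotopism_classes 'F_2 1| = 2,
      #|pq_ring_isotopism_classes 'F_2 2| = 7 &
      #|pq_ring_isotopism_classes 'F_2 3| = 72] /\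
  (forall s t : seq nat,
     (s, t) \in
       [:: ([:: 1;2;0; 2;0;0; 0;0;0], [:: 1;2;0; 2;1;0; 0;0;0]);
           ([:: 1;2;0; 2;0;0; 0;0;1], [:: 1;2;0; 2;1;0; 0;0;1]);
           ([:: 1;2;0; 2;0;0; 0;0;3], [:: 1;2;0; 2;1;0; 0;0;3]);
           ([:: 1;2;0; 0;1;0; 3;0;0], [:: 1;2;0; 2;1;0; 3;0;0]);
           ([:: 1;2;0; 0;1;3; 0;0;0], [:: 1;2;3; 2;1;0; 0;0;0]);
           ([:: 1;2;0; 0;1;0; 3;0;2], [:: 1;2;0; 2;1;0; 3;0;1]);
           ([:: 1;2;0; 2;0;3; 0;0;1], [:: 1;2;0; 2;1;3; 0;0;1]);
           ([:: 1;2;0; 0;1;3; 3;0;0], [:: 1;2;0; 2;1;3; 3;0;0]);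
           ([:: 1;2;0; 0;1;3; 3;0;2], [:: 1;2;3; 2;1;0; 3;0;1])] ->
     [/\ array_of_digits 3 s \in partial_latin_squares 3,
         array_of_digits 3 t \in partial_latin_squares 3,
         ~ pls_isotopic (array_of_digits 3 s) (array_of_digits 3 t) &
         isotopic (pq_ring 'F_2 (array_of_digits 3 s))
                  (pq_ring 'F_2 (array_of_digits 3 t))]).
Proof.
split; first by split; apply: card_ring_classes;
  [exact: classifies1 | exact: classifies2 | exact: classifies3].
move=> s t; rewrite -[X in _ \in X]/(map fst coincidences3).
case/mapP=> c /(allP coincidences3_properties)/and4P[latin_s latin_t cells iso_c] st.
move: latin_s latin_t cells iso_c; rewrite /is_coincidence.
case: c st => -[_ _] [[F G] H] /= [<- <-] latin_s latin_t cells iso_c.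
split; rewrite ?inE -?latin_digitsE //.
  by move/pls_isotopic_card_filled/eqP; rewrite !card_filled_digits; apply/negP.
exact: isotopic_bit_isotopism iso_c.
Qed.
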